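(* Let $K$ be a field, let $r\ge 2$ and $m,n\ge 1$ be integers, and let $f(X_1,\ldots,X_r)=a_0+a_1X_r+\cdots+a_mX_r^m$ and $g(X_1,\ldots,X_r)=b_0+b_1X_r+\cdots+b_nX_r^n$, with $a_0,a_1,\ldots,a_m,b_0,b_1,\ldots,b_n\in K[X_1,\ldots,X_{r-1}]$ and $a_0a_mb_n\neq 0$. If $a_m=p\cdot q$ with $p,q\in K[X_1,\ldots,X_{r-1}]$, $p$ a prime element of the ring $K[X_1,\ldots,X_{r-1}]$, such that for an index $j\in\{1,\ldots,r-1\}$, $$\deg_{X_j}p>\max\{(m-1)\deg_{X_j}q,\ (n-1)\deg_{X_j}q+mn\deg_{X_j}b_n\}+H_j(f),$$ then the polynomial $f(X_1,\ldots,X_{r-1},g(X_1,\ldots,X_r))$ is irreducible over the field $K(X_1,\ldots,X_{r-1})$.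
   Context: For a polynomial $u$ in several variables, $\deg_{X_j}u$ is its degree as a polynomial in $X_j$ with coefficients in the polynomial ring in the remaining variables. For $f=a_0+a_1X_r+\cdots+a_mX_r^m$ with $a_i\in K[X_1,\ldots,X_{r-1}]$, $a_m\neq 0$, and $j\in\{1,\ldots,r-1\}$, $H_j(f)=\max\{\deg_{X_j}a_0,\deg_{X_j}a_1,\ldots,\deg_{X_j}a_{m-1}\}$ (zero coefficients are ignored in the maximum, i.e. $\deg_{X_j}0=-\infty$). ''Irreducible over $K(X_1,\ldots,X_{r-1})$'' means irreducible as a polynomial in $X_r$ with coefficients in the field $K(X_1,\ldots,X_{r-1})$. *)

(* Defs.v *)
(* Mathematical Components world. *)
From HB Require Import structures.
From mathcomp Require Export all_boot all_order all_algebra.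
From mathcomp Require Export mpoly.

Set Implicit Arguments.
Unset Strict Implicit.
Unset Printing Implicit Defensive.

Import GRing.Theory.
Local Open Scope ring_scope.

(* u seen as a polynomial in X_j: X_j is sent to the new indeterminate 'X, and
   the other variables to themselves as constants, so the coefficients are
   polynomials in the remaining variables. *)
Definition poly_in (K : fieldType) (k : nat) (j : 'I_k) (u : {mpoly K[k]})
    : {poly {mpoly K[k]}} :=
  mmap (polyC \o @mpolyC k K) (fun i => if i == j then 'X else ('X_i)%:P) u.

(* Valued in nat, so the zero polynomial gets degree 0 here, not -oo. *)
Definition degX (K : fieldType) (k : nat) (j : 'I_k) (u : {mpoly K[k]}) : nat :=
  (size (poly_in j u)).-1.

(* The leading coefficient, of index (size f).-1, does not enter the maximum.
   The value is 0 when all the other coefficients vanish. *)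
Definition Hdeg (K : fieldType) (k : nat) (j : 'I_k)
    (f : {poly {mpoly K[k]}}) : nat :=
  (\max_(i < (size f).-1 | (f`_i != 0)%R) degX j (f`_i)%R)%N.

Definition divides (R : comNzRingType) (a b : R) : Prop := exists c, b = a * c.

Definition prime_element (R : comUnitRingType) (p : R) : Prop :=
  [/\ p != 0, p \isn't a GRing.unit
    & forall a b : R, divides p (a * b) -> divides p a \/ divides p b].

(* Main.v *)
Require Import Defs.
From Stdlib Require Import Classical_Prop.
From HB Require Import structures.
From mathcomp Require fieldext.
From mathcomp Require Import zify ring.
Import GRing.Theory.
Local Open Scope ring_scope.

(** Only one variable matters.  Write Y for X_j and let F be the fraction
    field of the polynomials in the variables other than X_j and X_r.
    Inverting those polynomials turns the ring of coefficients into F[Y]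
    ([localize]); degrees in X_j become degrees in Y, and the prime p stays
    prime because its degree in X_j is positive
    ([prime_irreducible_localize]).  A factorization of the composition over
    K(X_1, ..., X_(r-1)) has, up to a denominator, coefficients in K[X_1,
    ..., X_(r-1)], so it also splits the image over F[Y]
    ([irreducible_of_injective]).  It remains to prove the criterion for f, g
    with coefficients in F[Y] ([irreducible_comp_big_prime]), where Gauss's
    lemma holds ([gauss_factor]).

    First, f is irreducible.  As p divides the leading coefficient p * q, it
    divides the leading coefficient of one factor, so the leading coefficient
    t of the other one divides q.  All other coefficients of f have degree at
    most H = H_j(f), so every root of f has degree at most (H - deg(p q)) /
    m, in the sense of the valuation at infinity.  The constant term of the
    second factor is a nonzero polynomial, hence of nonnegative degree, and
    it is up to sign t times a product of such roots.  So m * deg t >= deg p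
    + deg q - H, which contradicts deg t <= deg q and deg p > (m - 1) deg q +
    H.  The Newton polygon argument [newton_factor] gives this bound without
    extending the valuation.

    Next, suppose that the composition is h1 * h2 with both degrees
    positive.  The prime p divides the leading coefficient of f but not
    its constant term, whose degree is at most H.  Let x be a root of h2.
    Then g(x) is a root of the irreducible f.  If p did not divide the
    leading coefficient of h2, then x, hence also g(x), would be integral
    over F[Y] localized at p, whereas the minimal polynomial of g(x),
    namely f made monic, is not integral there.  So p divides the leading
    coefficient of h2 and, by symmetry, that of h1
    ([lead_coef_value_dvd]).  Hence p^2 divides p * q * b_n^m, so p
    divides q or b_n.  As the composition splits, mn > 1, and then the
    hypothesis on deg p excludes both. *)

Set Implicit Arguments.
Unset Strict Implicit.
Unset Printing Implicit Defensive.

(** * Gauss's lemma for polynomials over F[Y] *)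

(** Irreducibility is not decidable over an arbitrary field, so a
    reducible polynomial is recognized classically and yields a divisor of
    smaller size. *)
Lemma irreducible_factor (F : fieldType) (h : {poly F}) :
  (1 < size h)%N -> exists2 q, irreducible_poly q & q %| h.
Proof.
have [s] := ubnP (size h); elim: s h => // s IHs h lt_h h_gt1.
have [irr_h | red_h] := classic (irreducible_poly h); first by exists h.
have [u [u_n1 u_dvd u_neq]] : exists u : {poly F},
    [/\ size u != 1%N, u %| h & ~~ (u %= h)].
  apply: NNPP => no_u; apply: red_h; split=> // u u_n1 u_dvd.
  by apply/negPn/negP => u_neq; apply: no_u; exists u.
have h_neq0 : h != 0 by rewrite -size_poly_gt0 ltnW.
have u_neq0 : u != 0 by apply: contraTneq u_dvd => ->; rewrite dvd0p.
have lt_uh : (size u < size h)%N.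
  by rewrite ltn_neqAle dvdp_leq // andbT dvdp_size_eqp.
have [||q irr_q q_dvd] := IHs u.
- by apply: leq_trans lt_uh _; rewrite -ltnS.
- by move: u_n1 u_neq0; rewrite -size_poly_gt0; case: (size u) => [|[]].
by exists q => //; apply: dvdp_trans u_dvd.
Qed.

Lemma irreducible_dvdpM (F : fieldType) (w a b : {poly F}) :
  irreducible_poly w -> w %| a * b -> (w %| a) || (w %| b).
Proof.
move=> irr_w w_dvd; have [//|w_ndvd /=] := boolP (w %| a).
rewrite -(@Gauss_dvdpr _ _ a) //; apply: contraR w_ndvd => ncop.
by rewrite -(eqp_dvdl _ (irr_w _ ncop (dvdp_gcdl _ _))) dvdp_gcdr.
Qed.

Lemma irreducible_dvdpX (F : fieldType) (w a : {poly F}) k :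
  irreducible_poly w -> w %| a ^+ k -> w %| a.
Proof.
move=> irr_w; elim: k => [|k IHk].
  rewrite expr0 dvdp1 => /eqP w1; by case: irr_w; rewrite w1.
by rewrite exprS => /(irreducible_dvdpM irr_w)/orP[].
Qed.

Lemma dvd_coefs_scale (F : fieldType) (w : {poly F}) (h : {poly {poly F}}) :
  (forall i, w %| h`_i) -> exists k, h = w *: k.
Proof.
move=> w_dvd; exists (map_poly (fun a => a %/ w) h); apply/polyP => i.
by rewrite coefZ coef_map_id0 ?div0p // mulrC divpK.
Qed.

(** Reduce the coefficients of both factors modulo [w].  If neither
    reduction vanishes, its leading coefficient is a nonzero remainder,
    hence prime to [w], and so is the leading coefficient of the product
    of the reductions, which is congruent to [h1 * h2]. *)
Lemma irreducible_dvd_coefsM (F : fieldType) (w : {poly F})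
    (h1 h2 : {poly {poly F}}) :
  irreducible_poly w -> (forall i, w %| (h1 * h2)`_i) ->
  (forall i, w %| h1`_i) \/ (forall i, w %| h2`_i).
Proof.
move=> irr_w w_dvd.
pose rem h := map_poly (fun a => a %% w) h.
pose quo h := map_poly (fun a => a %/ w) h.
have coef_rem h i : (rem h)`_i = h`_i %% w by rewrite coef_map_id0 ?mod0p.
have split_h h : h = rem h + w *: quo h.
  apply/polyP => i; rewrite coefD coefZ coef_rem coef_map_id0 ?div0p //.
  by rewrite addrC mulrC -divp_eq.
have rem0 h : rem h = 0 -> forall i, w %| h`_i.
  by move=> h0 i; rewrite /dvdp -coef_rem h0 coef0.
have [/rem0|n1] := eqVneq (rem h1) 0; first by left.
have [/rem0|n2] := eqVneq (rem h2) 0; first by right.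
have lc_ndvd h : rem h != 0 -> ~~ (w %| lead_coef (rem h)).
  move=> nz; rewrite /dvdp {1}lead_coefE coef_rem modp_id -coef_rem -lead_coefE.
  by rewrite lead_coef_eq0.
have : w %| lead_coef (rem h1 * rem h2).
  have -> : rem h1 * rem h2 =
      h1 * h2 - w *: (rem h1 * quo h2 + quo h1 * rem h2 +
                      w *: (quo h1 * quo h2)).
    by rewrite {2}(split_h h1) {2}(split_h h2) -!mul_polyC; ring.
  rewrite lead_coefE; set i := _.-1; rewrite coefB coefZ.
  by rewrite dvdp_sub ?dvdp_mulr.
rewrite lead_coefM => /(irreducible_dvdpM irr_w).
by rewrite !(negPf (lc_ndvd _ _)).
Qed.

Lemma scale_poly_inj (R : idomainType) (c : R) : c != 0 ->
  injective (fun p : {poly R} => c *: p).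
Proof.
move=> c_neq0 a b /eqP; rewrite -subr_eq0 -scalerBr scale_poly_eq0.
by rewrite (negPf c_neq0) subr_eq0 => /eqP.
Qed.

Lemma ltn_size_mulr (R : idomainType) (d w : {poly R}) :
  d != 0 -> (1 < size w)%N -> (size d < size (d * w)%R)%N.
Proof.
move=> d_neq0 w_gt1.
have w_neq0 : w != 0 by rewrite -size_poly_gt0 ltnW.
by rewrite size_mul //; move: d_neq0 w_gt1; rewrite -size_poly_gt0; lia.
Qed.

(** Divisibility over the fraction field descends to divisibility in the
    localization at [w], as soon as the divisor [f] is primitive at [w]:
    each factor [w] of the denominator [c] must divide the cofactor [k],
    and so can be cancelled. *)
Lemma gauss_at_prime (F : fieldType) (w c : {poly F})
    (f k h : {poly {poly F}}) i0 :
  irreducible_poly w -> ~~ (w %| f`_i0) -> c != 0 -> c *: h = f * k ->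
  exists c' k', ~~ (w %| c') /\ c' *: h = f * k'.
Proof.
move=> irr_w f_prim; have [s] := ubnP (size c).
elim: s c k => // s IHs c k lt_c c_neq0 def_h.
have [/dvdpP[d def_c]|ndvd] := boolP (w %| c); last by exists c, k.
have w_neq0 := irredp_neq0 irr_w.
have [|f_dvd|k_dvd] := @irreducible_dvd_coefsM _ w f k irr_w.
- by move=> i; rewrite -def_h coefZ def_c -mulrA dvdp_mull ?dvdp_mulr.
- by rewrite f_dvd in f_prim.
have [k' def_k] := dvd_coefs_scale k_dvd.
move: c_neq0; rewrite def_c mulf_eq0 (negPf w_neq0) orbF => d_neq0.
apply: (IHs d k') => //.
  by apply: leq_trans (ltn_size_mulr d_neq0 irr_w.1) _; rewrite -def_c -ltnS.
apply: (scale_poly_inj w_neq0); rewrite scalerA mulrC -def_c def_h def_k.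
by rewrite scalerAr.
Qed.

(** Every prime factor of the denominator [c] divides one of the two
    factors and is cancelled there; what remains in the end is a unit of
    F[Y]. *)
Lemma gauss_factor (F : fieldType) (c : {poly F}) (f h1 h2 : {poly {poly F}}) :
  c != 0 -> c *: f = h1 * h2 ->
  exists k1 k2, [/\ f = k1 * k2, size k1 = size h1 & size k2 = size h2].
Proof.
have [s] := ubnP (size c).
elim: s c h1 h2 => // s IHs c h1 h2 lt_c c_neq0 def_f.
have [c_gt1|c_le1] := ltnP 1 (size c); last first.
  have u : c \is a GRing.unit.
    rewrite (size1_polyC c_le1) polyC_eq0 in c_neq0 *.
    by rewrite poly_unitE size_polyC c_neq0 coefC unitfE.
  exists (c^-1 *: h1), h2; split=> //.
    by rewrite -scalerAl -def_f scalerA mulVr ?scale1r.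
  by rewrite size_scale // invr_eq0.
have [w irr_w /dvdpP[d def_c]] := irreducible_factor c_gt1.
have w_neq0 := irredp_neq0 irr_w.
have d_neq0 : d != 0 by apply: contraNneq c_neq0 => d0; rewrite def_c d0 mul0r.
have lt_d : (size d < s)%N.
  by apply: leq_trans (ltn_size_mulr d_neq0 irr_w.1) _; rewrite -def_c -ltnS.
have := @irreducible_dvd_coefsM _ w h1 h2 irr_w.
case=> [i|/dvd_coefs_scale[k def_h]|/dvd_coefs_scale[k def_h]].
- by rewrite -def_f coefZ def_c -mulrA dvdp_mull ?dvdp_mulr.
- have [|k1 [k2 [-> sz1 sz2]]] := IHs d k h2 lt_d d_neq0.
    apply: (scale_poly_inj w_neq0); rewrite scalerA mulrC -def_c def_f def_h.
    by rewrite scalerAl.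
  by exists k1, k2; rewrite sz1 sz2 def_h size_scale.
have [|k1 [k2 [-> sz1 sz2]]] := IHs d h1 k lt_d d_neq0.
  apply: (scale_poly_inj w_neq0); rewrite scalerA mulrC -def_c def_f def_h.
  by rewrite scalerAr.
by exists k1, k2; rewrite sz1 sz2 def_h size_scale.
Qed.

(** * Newton polygons with respect to a degree *)

Lemma last_argmax (P : pred nat) (v : nat -> nat) n k0 : (k0 <= n)%N -> P k0 ->
  exists2 i, P i & forall k, (k <= n)%N -> P k ->
    (v k <= v i)%N /\ ((i < k)%N -> (v k < v i)%N).
Proof.
move=> k0n Pk0.
have {k0 k0n Pk0} : exists2 k, P k & (k <= n)%N by exists k0.
elim: n => [|n IHn] [k0 Pk0 k0n].
  exists k0 => // k; rewrite !leqn0 in k0n *; move/eqP: k0n => -> /eqP -> _.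
  by [].
have [ex|nex] := boolP (has P (iota 0 n.+1)); last first.
  exists k0 => // k kn Pk.
  have late l : P l -> (n < l)%N.
    move=> Pl; rewrite ltnNge; apply: contra nex => ln.
    by apply/hasP; exists l; rewrite // mem_iota.
  have -> : k = k0 by have := late _ Pk; have := late _ Pk0; lia.
  by rewrite ltnn.
have {ex}/IHn[i Pi max_i] : exists2 k, P k & (k <= n)%N.
  by have /hasP[k] := ex; rewrite mem_iota => /andP[_ kn] Pk; exists k.
have [/andP[Pn le_i]|] := boolP (P n.+1 && (v i <= v n.+1)%N).
  exists n.+1 => // k kn Pk; split; last by lia.
  have [kn'|] := leqP k n; first by have [+ _] := max_i _ kn' Pk; lia.
  by move=> ?; have -> : k = n.+1 by lia.
move=> not_top; exists i => // k kn Pk.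
have [kn'|] := leqP k n; first exact: max_i.
move=> ?; have kE: k = n.+1 by lia.
move: not_top; rewrite -kE Pk /= -ltnNge => lt_v.
by split => [|_ //]; apply: ltnW.
Qed.

(** The properties of the degree on F[Y] that make it the opposite of a
    valuation.  Working with them, instead of the degree itself, keeps the
    Newton polygon argument to a single layer of polynomials. *)
Record degree_like (R : idomainType) (d : R -> nat) : Prop := DegreeLike {
  degM : forall a b : R, a != 0 -> b != 0 -> d (a * b) = (d a + d b)%N;
  degD_le : forall a b, (d (a + b)%R <= maxn (d a) (d b))%N;
  degD_lt : forall a b, (d b < d a)%N -> d (a + b) = d a }.

(** Give the term [a *: 'X^i] the weight [M * d a - i * dl], so that
    [newton_top] picks the last index of maximal weight.  The inequalities
    are written with the subtracted terms moved across, to stay in the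
    natural numbers. *)
Definition newton_top (R : idomainType) (d : R -> nat) (M dl : nat)
    (h : {poly R}) i :=
  h`_i != 0 /\ forall k, h`_k != 0 ->
    (M * d (h`_k)%R + i * dl <= M * d (h`_i)%R + k * dl)%N /\
    ((i < k)%N -> (M * d (h`_k)%R + i * dl < M * d (h`_i)%R + k * dl)%N).

Lemma newton_top_exists (R : idomainType) (d : R -> nat) M dl (h : {poly R}) :
  h != 0 -> exists i, newton_top d M dl h i.
Proof.
move=> h_neq0.
pose v k := (M * d (h`_k)%R + (size h - k) * dl)%N.
have lc_neq0 : h`_(size h).-1 != 0 by rewrite -lead_coefE lead_coef_eq0.
have [i hi top_i] :=
  @last_argmax (fun k => h`_k != 0) v (size h) _ (leq_pred _) lc_neq0.
have lt_size k : h`_k != 0 -> (k < size h)%N.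
  by apply: contra_neqT; rewrite -leqNgt => /(nth_default 0).
exists i; split=> // k hk; have lt_k := lt_size k hk; have lt_i := lt_size i hi.
have [] := top_i k (ltnW lt_k) hk; rewrite /v.
move: (M * _)%N (M * _)%N => a b.
have -> : ((size h - k) * dl = size h * dl - k * dl)%N by rewrite mulnBl.
have -> : ((size h - i) * dl = size h * dl - i * dl)%N by rewrite mulnBl.
have := leq_mul (ltnW lt_k) (leqnn dl); have := leq_mul (ltnW lt_i) (leqnn dl).
by lia.
Qed.

(** The product of the two extremal terms dominates all other
    contributions to its coefficient: another pair of indices with the
    same sum has one index past the last maximum, hence strictly smaller
    total weight. *)
Lemma newton_top_mul (R : idomainType) (d : R -> nat) M dl (h1 h2 : {poly R})
    i1 i2 :
  degree_like d -> (0 < M)%N ->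
  newton_top d M dl h1 i1 -> newton_top d M dl h2 i2 ->
  d (h1 * h2)`_(i1 + i2) = (d (h1`_i1)%R + d (h2`_i2)%R)%N.
Proof.
move=> [dM dD_le dD_lt] M_gt0 [nz1 top1] [nz2 top2].
have lt_i1 : (i1 < (i1 + i2).+1)%N by rewrite ltnS leq_addr.
rewrite coefM (bigD1 (Ordinal lt_i1)) //= addKn -dM //.
set rest := (\sum_(i | _) _).
have [->|] : rest = 0 \/ (d rest < d (h1`_i1 * h2`_i2)%R)%N; last first.
- exact: dD_lt.
- by rewrite addr0.
apply: (big_ind (fun a => a = 0 \/ (d a < d (h1`_i1 * h2`_i2)%R)%N)).
- by left.
- move=> a b [->|lt_a] [->|lt_b]; rewrite ?addr0 ?add0r; [by left|by right..|].
  by right; apply: leq_ltn_trans (dD_le _ _) _; rewrite gtn_max lt_a.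
move=> [j lt_j] /=; rewrite -val_eqE /= => neq_j.
have [->|nz1j] := eqVneq h1`_j 0; first by left; rewrite mul0r.
have [->|nz2j] := eqVneq h2`_(i1 + i2 - j) 0; first by left; rewrite mulr0.
have [le1 lt1] := top1 _ nz1j; have [le2 lt2] := top2 _ nz2j.
right; rewrite !dM // -(ltn_pmul2l M_gt0) !mulnDr.
have split_dl : (j * dl + (i1 + i2 - j) * dl = i1 * dl + i2 * dl)%N.
  by rewrite -!mulnDl subnKC.
have : (i1 < j)%N || (i2 < i1 + i2 - j)%N by move: neq_j; lia.
move: (M * _)%N (M * _)%N (M * _)%N (M * _)%N le1 lt1 le2 lt2 split_dl.
move: (_ * dl)%N (_ * dl)%N (_ * dl)%N (_ * dl)%N.
by move=> A B C D a b a' b' le1 lt1 le2 lt2 eqA /orP[/lt1|/lt2]; lia.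
Qed.

(** With [dl = d (lead_coef f) - H] the leading term of [f] has maximal
    weight, so the same holds for both factors, since weights add up.
    Comparing the leading term of [h2] with its nonzero constant term
    gives [m * d (lead_coef h2) >= (size h2).-1 * dl].  In terms of roots:
    all roots of [f] are small at infinity, at least [dl / m] below 0 in
    degree, and the product of the roots of [h2] is, up to sign, its
    constant term over its leading coefficient. *)
Lemma newton_factor (R : idomainType) (d : R -> nat) (f h1 h2 : {poly R}) m H :
  degree_like d -> size f = m.+1 -> f`_0 != 0 -> f = h1 * h2 ->
  (1 < size h2)%N -> (forall i, (i < m)%N -> (d (f`_i)%R <= H)%N) ->
  (H < d (lead_coef f))%N ->
  (d (lead_coef f) - H <= m * d (lead_coef h2))%N.
Proof.
move=> deg_d size_f f0_neq0 def_f h2_gt1 le_H lt_H.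
set dl := (_ - H)%N.
have f_neq0 : f != 0 by rewrite -size_poly_gt0 size_f.
have [h1_neq0 h2_neq0] : h1 != 0 /\ h2 != 0.
  by apply/andP; rewrite -negb_or -mulf_eq0 -def_f.
have [h10 h20] : h1`_0 != 0 /\ h2`_0 != 0.
  by apply/andP; rewrite -negb_or -mulf_eq0 -coef0M -def_f.
have sum_deg : (m = (size h1).-1 + (size h2).-1)%N.
  have := size_mul h1_neq0 h2_neq0; rewrite -def_f size_f.
  by move: h1_neq0; rewrite -size_poly_gt0; lia.
have m_gt0 : (0 < m)%N by lia.
have lc1 : lead_coef h1 != 0 by rewrite lead_coef_eq0.
have lc2 : lead_coef h2 != 0 by rewrite lead_coef_eq0.
have [i1 top1] := newton_top_exists d m dl h1_neq0.
have [i2 top2] := newton_top_exists d m dl h2_neq0.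
have dE := newton_top_mul deg_d m_gt0 top1 top2; rewrite -def_f in dE.
case: top1 => nz1 top1; case: top2 => nz2 top2.
have lc_deg : (d (lead_coef f) = d (lead_coef h1) + d (lead_coef h2))%N.
  by rewrite def_f lead_coefM (degM deg_d).
have le_size (h : {poly R}) i : h`_i != 0 -> (i <= (size h).-1)%N.
  apply: contra_neqT; rewrite -ltnNge => lt_i; apply: nth_default.
  by move: lt_i; case: (size h).
have i1_le := le_size _ _ nz1; have i2_le := le_size _ _ nz2.
have [] := top1 _ lc1; have [] := top2 _ lc2; rewrite -!lead_coefE.
have [lt_m|ge_m] := ltnP (i1 + i2) m; last first.
  have i2E : i2 = (size h2).-1 by clear -i1_le i2_le sum_deg ge_m; lia.
  have [+ _] := top2 _ h20; rewrite i2E -lead_coefE mul0n addn0 => le0 _ _ _ _.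
  rewrite -[leqLHS]mul1n; apply: leq_trans (leq_trans (leq_addl _ _) le0).
  by rewrite leq_mul2r -ltnS prednK ?h2_gt1 ?orbT // ltnW.
have := le_H _ lt_m; rewrite dE => le_i.
have : (m * (d (h1`_i1)%R + d (h2`_i2)%R) <= m * H)%N.
  by rewrite leq_mul2l le_i orbT.
have : (m * H + m * dl = m * d (lead_coef h1) + m * d (lead_coef h2))%N.
  by rewrite -!mulnDr -lc_deg subnKC // ltnW.
have : (m * dl = (size h1).-1 * dl + (size h2).-1 * dl)%N.
  by rewrite -mulnDl -sum_deg.
have : (i1 < (size h1).-1)%N || (i2 < (size h2).-1)%N.
  by clear -i1_le i2_le sum_deg lt_m; lia.
rewrite mulnDr; clear -m_gt0; move: (m * H)%N (m * dl)%N => mH mdl.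
move: (m * _)%N (m * _)%N (m * _)%N (m * _)%N => a1 a2 b1 b2.
move: (_ * dl)%N (_ * dl)%N (_ * dl)%N (_ * dl)%N.
by move=> x1 x2 y1 y2 /orP[] lt_i e1 e2 e3 le2 lt2 le1 lt1;
  [have := lt1 lt_i | have := lt2 lt_i]; lia.
Qed.

(** * Irreducibility over an integral domain and over its fraction field *)

(** Over an integral domain, [irreducible_poly] refers to
    pseudo-divisibility, that is to divisibility over the fraction field.
    This lemma and the next one turn it into a statement about products up
    to a constant. *)
Lemma irreducible_polyI (R : idomainType) (f : {poly R}) : (1 < size f)%N ->
  (forall c h1 h2, c != 0 -> c *: f = h1 * h2 ->
     (size h1 <= 1)%N || (size h2 <= 1)%N) ->
  irreducible_poly f.
Proof.
move=> f_gt1 no_split; split=> // q q_n1 /[dup] q_dvd.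
have f_neq0 : f != 0 by rewrite -size_poly_gt0 ltnW.
case/Pdiv.Idomain.dvdpP=> -[c s] /= c_neq0 def_f.
have : s * q != 0 by rewrite -def_f scale_poly_eq0 negb_or c_neq0.
rewrite mulf_eq0 negb_or => /andP[s_neq0 q_neq0].
case/orP: (no_split _ _ _ c_neq0 def_f) => [s_le1|q_le1].
  rewrite -Pdiv.Idomain.dvdp_size_eqp // -(size_scale f c_neq0) def_f.
  rewrite size_mul //; move: s_le1 s_neq0; rewrite -size_poly_gt0.
  by case: (size s) => [|[]].
by move: q_n1 q_le1 q_neq0; rewrite -size_poly_gt0; case: (size q) => [|[]].
Qed.

Lemma irreducible_split (R : idomainType) (f h1 h2 : {poly R}) c :
  irreducible_poly f -> c != 0 -> c *: f = h1 * h2 ->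
  (size h1 <= 1)%N || (size h2 <= 1)%N.
Proof.
move=> irr_f c_neq0 def_f; have f_neq0 := irredp_neq0 irr_f.
have : h1 * h2 != 0 by rewrite -def_f scale_poly_eq0 negb_or c_neq0.
rewrite mulf_eq0 negb_or => /andP[h1_neq0 h2_neq0].
have [->|h2_n1] := eqVneq (size h2) 1%N; first by rewrite orbT.
have /irr_f : h2 %| f by apply/Pdiv.Idomain.dvdpP; exists (c, h1).
move=> /(_ h2_n1)/eqp_size size_h2; apply/orP; left.
have := size_mul h1_neq0 h2_neq0; rewrite -def_f size_scale // size_h2.
by move: f_neq0; rewrite -size_poly_gt0; clear; lia.
Qed.

Lemma tofrac_inj (R : idomainType) : injective (@tofrac R).
Proof. by move=> x y /eqP; rewrite tofrac_eq => /eqP. Qed.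

Lemma fractionP (R : idomainType) (x : {fraction R}) :
  exists n d : R, d != 0 /\ tofrac d * x = tofrac n.
Proof.
elim/quotW: x => r; exists (frac r).1, (frac r).2; split.
  exact: denom_ratioP.
unlock FracField.tofrac; rewrite -[LHS]FracField.pi_mul.
apply/eqmodP; rewrite /= FracField.equivfE /FracField.mulf.
rewrite !numden_Ratio ?(oner_eq0, mulf_neq0, denom_ratioP) //.
by apply/eqP; ring.
Qed.

Lemma clear_denominators (R : idomainType) (s : {poly {fraction R}}) :
  exists (c : R) (s0 : {poly R}),
    c != 0 /\ tofrac c *: s = map_poly (@tofrac R) s0.
Proof.
have distribute (A : comNzRingType) (u v S T X : A) :
    u * v * (S * T + X) = u * (v * S) * T + v * (u * X) by ring.
elim/poly_ind: s => [|s x [c [s0 [c_neq0 def_s]]]].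
  by exists 1, 0; rewrite oner_eq0 scaler0 rmorph0.
have [n [d [d_neq0 def_x]]] := fractionP x.
exists (d * c), ((d *: s0) * 'X + (c * n)%:P).
split; first by rewrite mulf_neq0.
rewrite rmorphD !rmorphM /= map_polyX !map_polyC /= map_polyZ -def_s.
by rewrite ?rmorphM /= -def_x -!mul_polyC !polyCM; apply: distribute.
Qed.

Lemma irreducible_tofrac (R : idomainType) (f : {poly R}) :
  irreducible_poly f -> irreducible_poly (map_poly (@tofrac R) f).
Proof.
have inj_tofrac := @tofrac_inj R.
have size_tofrac (h : {poly R}) : size (map_poly (@tofrac R) h) = size h.
  exact: size_map_inj_poly.
move=> irr_f; apply: irreducible_polyI.
  by rewrite size_tofrac; case: irr_f.
move=> x h1 h2 x_neq0 def_f.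
have [c1 [k1 [c1_neq0 def_k1]]] := clear_denominators h1.
have [c2 [k2 [c2_neq0 def_k2]]] := clear_denominators h2.
have [n [d [d_neq0 def_x]]] := fractionP x.
have n_neq0 : n != 0.
  by rewrite -tofrac_eq0 -def_x mulf_neq0 ?tofrac_eq0.
have cn_neq0 : c1 * c2 * n != 0 by rewrite !mulf_neq0.
have def_f' : (c1 * c2 * n) *: f = (d *: k1) * k2.
  apply: (map_inj_poly inj_tofrac (rmorph0 _)).
  rewrite rmorphM /= !map_polyZ -def_k1 -def_k2 !rmorphM /= -def_x.
  have regroup (A : comNzRingType) (u1 u2 v y F g1 g2 : A) :
      y * F = g1 * g2 -> u1 * u2 * (v * y) * F = v * (u1 * g1) * (u2 * g2).
    move=> e; have -> : u1 * u2 * (v * y) * F = u1 * u2 * v * (y * F) by ring.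
    by rewrite e; ring.
  rewrite -mul_polyC in def_f; rewrite -!mul_polyC !polyCM.
  exact: regroup.
have size_clear c (h : {poly {fraction R}}) k : c != 0 ->
    tofrac c *: h = map_poly (@tofrac R) k -> size h = size k.
  by move=> c_neq0 e; rewrite -size_tofrac -e size_scale ?tofrac_eq0.
have := irreducible_split irr_f cn_neq0 def_f'.
by rewrite size_scale // (size_clear _ _ _ c1_neq0 def_k1)
  (size_clear _ _ _ c2_neq0 def_k2).
Qed.

(** A factorization over the smaller of the two fraction fields is one
    over the bigger, with the same degrees. *)
Lemma irreducible_of_injective (R S : idomainType) (phi : {rmorphism R -> S})
    (f : {poly R}) :
  injective phi -> irreducible_poly (map_poly phi f) -> irreducible_poly f.
Proof.
move=> inj_phi irr_f.
have size_phi (h : {poly R}) : size (map_poly phi h) = size h.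
  by apply: size_map_inj_poly => //; apply: rmorph0.
apply: irreducible_polyI; first by rewrite -size_phi; case: irr_f.
move=> c h1 h2 c_neq0 def_f; rewrite -(size_phi h1) -(size_phi h2).
apply: (irreducible_split (c := phi c) irr_f).
  by rewrite -(rmorph0 phi) (inj_eq inj_phi).
by rewrite -map_polyZ def_f rmorphM.
Qed.

(** * Integral values at roots *)

Section FieldExtension.
Import fieldext.

Lemma root_in_field_extension (F : fieldType) (h : {poly F}) : (1 < size h)%N ->
  exists (E : fieldType) (phi : {rmorphism F -> E}) (x : E),
    root (map_poly phi h) x.
Proof.
case/irreducible_factor => q irr_q q_dvd.
have [L _ [x root_x _]] := irredp_FAdjoin irr_q.
exists L, (in_alg L), x; apply: root_dvdp root_x.
by rewrite dvdp_map.
Qed.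

End FieldExtension.

Lemma root_in_extension (R : idomainType) (h : {poly R}) : (1 < size h)%N ->
  exists (E : fieldType) (phi : {rmorphism R -> E}) (x : E),
    injective phi /\ root (map_poly phi h) x.
Proof.
move=> h_gt1.
have inj_tofrac := @tofrac_inj R.
have [|E [phi [x root_x]]] :=
  @root_in_field_extension _ (map_poly (@tofrac R) h).
  by rewrite size_map_inj_poly.
exists E, (phi \o @tofrac R), x; split.
  by apply: inj_comp => //; apply: fmorph_inj.
by rewrite map_poly_comp.
Qed.

Lemma irreducible_dvd_common_root (R : idomainType) (E : fieldType)
    (phi : {rmorphism R -> E}) (f g : {poly R}) (x : E) :
  injective phi -> irreducible_poly f ->
  root (map_poly phi f) x -> root (map_poly phi g) x ->
  exists c k, c != 0 /\ c *: g = f * k.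
Proof.
move=> inj_phi irr_f fx gx.
have [cop|ncop] := boolP (coprimep f g).
  have /Pdiv.Idomain.Bezout_coprimepP[[u v] /= uv1] := cop.
  have /Pdiv.Idomain.eqpP[[a b] /= /andP[a_neq0 b_neq0] e] := uv1.
  have := congr1 (fun h => (map_poly phi h).[x]) e.
  rewrite !map_polyZ !rmorphD !rmorphM rmorph1 /= !hornerE.
  rewrite (rootP fx) (rootP gx) !mulr0 addr0 mulr0 => /esym/eqP.
  by rewrite -(rmorph0 phi) (inj_eq inj_phi) (negPf b_neq0).
have eq_f : gcdp f g %= f by apply: irr_f; rewrite ?Pdiv.Idomain.dvdp_gcdl.
have : f %| g.
  by rewrite -(Pdiv.Idomain.eqp_dvdl _ eq_f) Pdiv.Idomain.dvdp_gcdr.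
move/Pdiv.Idomain.dvdpP => [[c k] /= c_neq0 e].
by exists c, k; rewrite mulrC.
Qed.

(** Multiply [h] by the power [t ^+ (size h - 2)] of its leading
    coefficient [t]: the result is a monic polynomial in [t * x]. *)
Lemma integral_lead_coef_root (R : idomainType) (E : fieldType)
    (phi : {rmorphism R -> E}) (h : {poly R}) (x : E) :
  (1 < size h)%N -> root (map_poly phi h) x ->
  integralOver phi (phi (lead_coef h) * x).
Proof.
move=> h_gt1 hx; set t := lead_coef h.
have [d size_h] : exists d, size h = d.+2.
  by exists (size h - 2)%N; move: h_gt1; clear; lia.
pose u := \poly_(i < d.+2) (if i == d.+1 then 1 else h`_i * t ^+ (d - i)).
have size_u : size u = d.+2 by rewrite size_poly_eq // eqxx oner_neq0.
exists u.
  by rewrite monicE lead_coefE size_u coef_poly ltnSn eqxx.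
have map_u : map_poly phi u =
    \poly_(i < d.+2) (phi (if i == d.+1 then 1 else h`_i * t ^+ (d - i))).
  apply/polyP => i; rewrite coef_map !coef_poly.
  by case: (i < d.+2)%N; [reflexivity | exact: rmorph0].
have map_h : map_poly phi h = \poly_(i < d.+2) (phi h`_i).
  apply/polyP => i; rewrite coef_map coef_poly; case: ltnP => // le_i.
  have -> : h`_i = 0 by rewrite nth_default ?size_h.
  exact: rmorph0.
move: hx; rewrite /root map_u map_h !horner_poly => /eqP hx; apply/eqP.
transitivity (phi t ^+ d * \sum_(i < d.+2) phi h`_i * x ^+ i).
  2: by rewrite hx mulr0.
rewrite mulr_sumr; apply: eq_bigr => i _.
have [iE|neq_i] := eqVneq (i : nat) d.+1.
  rewrite iE rmorph1 mul1r exprMn mulrA exprS; congr (_ * _).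
  by rewrite mulrC /t lead_coefE size_h.
have le_i : (i <= d)%N by have := ltn_ord i; move: neq_i; clear; lia.
rewrite rmorphM rmorphXn exprMn /=.
have -> : phi t ^+ d = phi t ^+ (d - i) * phi t ^+ i by rewrite -exprD subnK.
by rewrite [_ * phi t ^+ _]mulrC mulrACA.
Qed.

(** [t ^+ size g * g(x)] is a polynomial in the integral element [t * x],
    hence a root of a monic polynomial; rescaling the variable puts the
    powers of [t] into the leading coefficient. *)
Lemma integral_value (R : idomainType) (E : fieldType)
    (phi : {rmorphism R -> E}) (h g : {poly R}) (x : E) :
  (1 < size h)%N -> root (map_poly phi h) x ->
  exists (k : nat) (u : {poly R}),
    lead_coef u = lead_coef h ^+ k /\
    root (map_poly phi u) (map_poly phi g).[x].
Proof.
move=> h_gt1 hx; set t := lead_coef h.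
have t_neq0 : t != 0 by rewrite lead_coef_eq0 -size_poly_gt0 ltnW.
pose n := size g.
have int_tx := integral_lead_coef_root h_gt1 hx; rewrite -/t in int_tx.
pose v := \poly_(i < n) phi (g`_i * t ^+ (n - i)).
have v_tx : v.[phi t * x] = phi (t ^+ n) * (map_poly phi g).[x].
  have -> : map_poly phi g = \poly_(i < n) phi g`_i by [].
  rewrite !horner_poly mulr_sumr; apply: eq_bigr => i _.
  rewrite rmorphM !rmorphXn exprMn /=.
  have -> : phi t ^+ n = phi t ^+ (n - i) * phi t ^+ i.
    by rewrite -exprD subnK // ltnW.
  by rewrite [_ * phi t ^+ _]mulrC mulrACA.
have [u mon_u root_u] : integralOver phi v.[phi t * x].
  apply: integral_horner int_tx; apply/integral_poly => i.
  rewrite coef_poly; case: ifP => _; first exact: integral_id.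
  exact: integral0.
have tX_neq0 : t ^+ n != 0 by rewrite expf_neq0.
exists (n * (size u).-1)%N, (u \Po (t ^+ n *: 'X)); split.
  rewrite lead_coef_comp ?size_scale ?size_polyX // lead_coefZ lead_coefX mulr1.
  by rewrite (monicP mon_u) mul1r exprM.
rewrite /root map_comp_poly horner_comp map_polyZ map_polyX hornerZ hornerX.
by rewrite -v_tx.
Qed.

(** * The criterion over F[Y] *)

(** A name for the degree, so that all occurrences share one syntactic form. *)
Definition pdeg (F : fieldType) (a : {poly F}) : nat := (size a).-1.

Lemma pdeg_dvd (F : fieldType) (a b : {poly F}) :
  b != 0 -> a %| b -> (pdeg a <= pdeg b)%N.
Proof.
move=> b_neq0 /(dvdp_leq b_neq0); rewrite /pdeg -!subn1.
exact: leq_sub2r.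
Qed.

Lemma degree_like_pdeg (F : fieldType) : degree_like (@pdeg F).
Proof.
have predD k l : (0 < k -> 0 < l -> (k + l).-1.-1 = k.-1 + l.-1)%N by lia.
have le_pred k l e : (k <= maxn l e -> k.-1 <= maxn l.-1 e.-1)%N by lia.
have lt_pred k l : (k.-1 < l.-1 -> k < l)%N by lia.
rewrite /pdeg; split=> [a b a_neq0 b_neq0|a b|a b lt_ba].
- by rewrite size_mul //; apply: predD; rewrite size_poly_gt0.
- exact/le_pred/size_polyD.
by rewrite size_polyDl //; apply: lt_pred.
Qed.

(** In a factorization over F[Y], the prime [w] divides the leading
    coefficient of [k1], say; then that of [k2] divides [q], and its
    degree is too small for [newton_factor]. *)
Lemma irreducible_big_prime (F : fieldType) (f : {poly {poly F}})
    (w q : {poly F}) m H :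
  irreducible_poly w -> size f = m.+1 -> (0 < m)%N -> f`_0 != 0 ->
  lead_coef f = w * q -> (forall i, (i < m)%N -> (pdeg (f`_i)%R <= H)%N) ->
  ((m - 1) * pdeg q + H < pdeg w)%N ->
  irreducible_poly f.
Proof.
move=> irr_w size_f m_gt0 f0_neq0 lead_f le_H lt_w.
apply: irreducible_polyI; first by rewrite size_f.
move=> c h1 h2 c_neq0 /(gauss_factor c_neq0)[k1 [k2 [def_f <- <-]]] {h1 h2}.
have deg := degree_like_pdeg F.
have f_neq0 : f != 0 by rewrite -size_poly_gt0 size_f.
have w_neq0 := irredp_neq0 irr_w.
have q_neq0 : q != 0.
  apply: contraTneq f_neq0 => q0.
  by rewrite -lead_coef_eq0 lead_f q0 mulr0 eqxx.
have lt_H : (H < pdeg (lead_coef f))%N.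
  rewrite lead_f (degM deg) //; move: lt_w; clear; lia.
wlog w_dvd : k1 k2 def_f / w %| lead_coef k1 => [sym|].
  have : w %| lead_coef k1 * lead_coef k2.
    by rewrite -lead_coefM -def_f lead_f dvdp_mulr.
  case/(irreducible_dvdpM irr_w)/orP; first exact: sym.
  by rewrite orbC; apply: sym; rewrite mulrC.
apply: contraT; rewrite negb_or -!ltnNge => /andP[_ k2_gt1].
have := newton_factor deg size_f f0_neq0 def_f k2_gt1 le_H lt_H.
have [s def_s] := dvdpP _ _ w_dvd.
have def_q : q = s * lead_coef k2.
  apply: (mulfI w_neq0); rewrite -lead_f def_f lead_coefM def_s mulrA.
  by rewrite [w * s]mulrC.
have : q != 0 by [].
rewrite def_q mulf_eq0 negb_or => /andP[s_neq0 k2_neq0].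
have le_k2 : (pdeg (lead_coef k2) <= pdeg q)%N.
  by rewrite def_q (degM deg) // leq_addl.
have le_mk2 : (m * pdeg (lead_coef k2) <= m * pdeg q)%N.
  by rewrite leq_mul2l le_k2 orbT.
have mq : (m * pdeg q = (m - 1) * pdeg q + pdeg q)%N.
  by rewrite -mulSnr subn1 prednK.
rewrite lead_f (degM deg) //; move: le_mk2 mq lt_w; clear.
move: (m * pdeg (lead_coef k2))%N (m * pdeg q)%N ((m - 1) * pdeg q)%N.
by lia.
Qed.

(** If [w] did not divide [lead_coef k2], a root [x] of [k2] would be
    integral at [w], and so would [g(x)], which is a root of the
    irreducible [f].  But the minimal polynomial of [g(x)] is [f] divided
    by its leading coefficient, whose constant term is not integral at
    [w].  The polynomial [u] below witnesses integrality, and Gauss's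
    lemma at [w] replaces the fact that minimal polynomials of integral
    elements are integral. *)
Lemma lead_coef_value_dvd (F : fieldType) (f g k1 k2 : {poly {poly F}})
    (w : {poly F}) :
  irreducible_poly f -> irreducible_poly w -> ~~ (w %| f`_0) ->
  w %| lead_coef f -> (1 < size k2)%N -> f \Po g = k1 * k2 ->
  w %| lead_coef k2.
Proof.
move=> irr_f irr_w w_f0 w_lc k2_gt1 def_k.
have [E [phi [x [inj_phi root_x]]]] := root_in_extension k2_gt1.
have [k [u [lead_u root_u]]] := integral_value g k2_gt1 root_x.
have root_f : root (map_poly phi f) (map_poly phi g).[x].
  rewrite /root -horner_comp -map_comp_poly def_k rmorphM hornerM /=.
  by rewrite (rootP root_x) mulr0.
have [c [v [c_neq0 def_u]]] :=
  irreducible_dvd_common_root inj_phi irr_f root_f root_u.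
have [c' [v' [w_c' def_u']]] := gauss_at_prime irr_w w_f0 c_neq0 def_u.
have : w %| c' * lead_coef u.
  by rewrite -lead_coefZ def_u' lead_coefM dvdp_mulr.
case/(irreducible_dvdpM irr_w)/orP; first by rewrite (negPf w_c').
by rewrite lead_u => /(irreducible_dvdpX irr_w).
Qed.

(** By [lead_coef_value_dvd], applied to each of the two factors of [f \Po
    g], the square of [w] would divide the leading coefficient [w * q *
    lead_coef g ^+ m]; the degree of [w] excludes this. *)
Lemma irreducible_comp_big_prime (F : fieldType) (f g : {poly {poly F}})
    (w q : {poly F}) m n H :
  irreducible_poly w -> size f = m.+1 -> (0 < m)%N -> size g = n.+1 ->
  (0 < n)%N -> f`_0 != 0 -> lead_coef f = w * q ->
  (forall i, (i < m)%N -> (pdeg (f`_i)%R <= H)%N) ->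
  (maxn ((m - 1) * pdeg q)
     ((n - 1) * pdeg q + m * n * pdeg (lead_coef g)) + H
   < pdeg w)%N ->
  irreducible_poly (f \Po g).
Proof.
move=> irr_w size_f m_gt0 size_g n_gt0 f0_neq0 lead_f le_H lt_w.
have deg := degree_like_pdeg F.
have irr_f : irreducible_poly f.
  apply: (irreducible_big_prime irr_w size_f m_gt0 f0_neq0 lead_f le_H).
  by move: lt_w; clear; lia.
have size_fg : (size (f \Po g)).-1 = (m * n)%N.
  by rewrite size_comp_poly size_f size_g.
have mn_gt0 : (0 < m * n)%N by rewrite muln_gt0 m_gt0.
have fg_gt1 : (1 < size (f \Po g)%R)%N.
  by move: mn_gt0; rewrite -size_fg; case: (size _) => [|[]].
apply: irreducible_polyI => //.
move=> c h1 h2 c_neq0 /(gauss_factor c_neq0)[k1 [k2 [def_k <- <-]]] {h1 h2}.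
apply: contraT; rewrite negb_or -!ltnNge => /andP[k1_gt1 k2_gt1].
have w_f0 : ~~ (w %| f`_0).
  apply/negP => /(pdeg_dvd f0_neq0) le_w.
  by have := le_H _ m_gt0; move: le_w lt_w; clear; lia.
have w_lc : w %| lead_coef f by rewrite lead_f dvdp_mulr.
have w_k2 := lead_coef_value_dvd irr_f irr_w w_f0 w_lc k2_gt1 def_k.
have w_k1 : w %| lead_coef k1.
  by apply: (@lead_coef_value_dvd _ f g k2 k1) => //; rewrite mulrC.
have w_neq0 := irredp_neq0 irr_w.
have f_neq0 : f != 0 by rewrite -size_poly_gt0 size_f.
have g_neq0 : g != 0 by rewrite -size_poly_gt0 size_g.
have q_neq0 : q != 0.
  apply: contraTneq f_neq0 => q0.
  by rewrite -lead_coef_eq0 lead_f q0 mulr0 eqxx.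
have : w * w %| w * (q * lead_coef g ^+ m).
  rewrite mulrA -lead_f -[m]/(m.+1.-1) -size_f -lead_coef_comp ?size_g //.
  by rewrite def_k lead_coefM dvdp_mul.
rewrite dvdp_mul2l // => /(irreducible_dvdpM irr_w)/orP[w_q|].
  have le_w := pdeg_dvd q_neq0 w_q.
  (* When m = n = 1 the hypothesis does not bound the degree of [q], but then
     the composition is linear and cannot split. *)
  have mn_gt1 : (1 < m)%N || (1 < n)%N.
    have : (1 < m * n)%N.
      have k1_neq0 : k1 != 0 by rewrite -size_poly_gt0 ltnW.
      have k2_neq0 : k2 != 0 by rewrite -size_poly_gt0 ltnW.
      have gt1D k l : (1 < k -> 1 < l -> 1 < (k + l).-1.-1)%N by clear; lia.
      rewrite -size_fg def_k (size_mul k1_neq0 k2_neq0).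
      exact: gt1D k1_gt1 k2_gt1.
    by move: m_gt0 n_gt0; clear; case: m n => [|[|?]] [|[|?]].
  have le_q k : (1 < k)%N -> (pdeg q <= (k - 1) * pdeg q)%N.
    by move=> k_gt1; rewrite -{1}[pdeg q]mul1n leq_mul2r subn_gt0 k_gt1 orbT.
  by case/orP: mn_gt1 => /le_q; move: le_w lt_w; clear;
    move: ((m - 1) * _)%N ((n - 1) * _)%N => *; lia.
move/(irreducible_dvdpX irr_w) => w_g.
have lg_neq0 : lead_coef g != 0 by rewrite lead_coef_eq0.
have le_w := pdeg_dvd lg_neq0 w_g.
have := leq_mul mn_gt0 (leqnn (pdeg (lead_coef g))).
by rewrite mul1n; move: le_w lt_w; clear; lia.
Qed.

(** * Separating one variable *)

Lemma mpoly_rmorphism_ext (n : nat) (K : nzRingType) (S : comNzRingType)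
    (phi psi : {rmorphism {mpoly K[n]} -> S}) :
  (forall c, phi c%:MP = psi c%:MP) -> (forall i, phi 'X_i = psi 'X_i) ->
  phi =1 psi.
Proof.
move=> eqC eqX u; elim/mpolyind: u => [|c m u _ _ IHu].
  by rewrite !rmorph0.
rewrite !rmorphD /= IHu -mul_mpolyC !rmorphM /= eqC mpolyXE_id !rmorph_prod /=.
by congr (_ * _ + _); apply: eq_bigr => i _; rewrite !rmorphXn /= eqX.
Qed.

Section SplitVariable.

Variables (K : fieldType) (k : nat) (j : 'I_k.+1).

Definition insert_var : {mpoly K[k]} -> {mpoly K[k.+1]} :=
  mmap (@mpolyC k.+1 K) (fun i => 'X_(lift j i)).

HB.instance Definition _ := GRing.RMorphism.on insert_var.

(** The coefficients given by [poly_in] live in a ring that still contains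
    X_j. Removing X_j from the coefficient ring makes the map an
    isomorphism, with inverse [join_var], and so carries primality over. *)
Definition split_var : {mpoly K[k.+1]} -> {poly {mpoly K[k]}} :=
  mmap (polyC \o @mpolyC k K)
    (fun i => oapp (fun i' => ('X_i')%:P) 'X (unlift j i)).

HB.instance Definition _ := GRing.RMorphism.on split_var.

Definition join_var : {poly {mpoly K[k]}} -> {mpoly K[k.+1]} :=
  horner_eval 'X_j \o map_poly insert_var.

HB.instance Definition _ := GRing.RMorphism.on join_var.

Lemma insert_varC c : insert_var c%:MP = c%:MP.
Proof. exact: mmapC. Qed.

Lemma insert_varX i : insert_var 'X_i = 'X_(lift j i).
Proof. by rewrite /insert_var mmapX mmap1U. Qed.

Lemma split_varC c : split_var c%:MP = (c%:MP)%:P.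
Proof. exact: mmapC. Qed.

Lemma split_varX i :
  split_var 'X_i = oapp (fun i' => ('X_i')%:P) 'X (unlift j i).
Proof. by rewrite /split_var mmapX mmap1U. Qed.

Lemma join_varC c : join_var c%:P = insert_var c.
Proof. by rewrite /join_var /= /horner_eval map_polyC hornerC. Qed.

Lemma join_varX : join_var 'X = 'X_j.
Proof. by rewrite /join_var /= /horner_eval map_polyX hornerX. Qed.

Lemma insert_var_inj : injective insert_var.
Proof.
pose erase :=
  mmap (@mpolyC k K) (fun i => oapp (fun i' => 'X_i') 0 (unlift j i)).
apply: (can_inj (g := erase)).
apply: (mpoly_rmorphism_ext
  (phi := erase \o insert_var) (psi := idfun)) => [c|i] /=.
  by rewrite insert_varC /erase mmapC.
by rewrite insert_varX /erase mmapX mmap1U liftK.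
Qed.

Lemma split_varK : cancel split_var join_var.
Proof.
apply: (mpoly_rmorphism_ext
  (phi := join_var \o split_var) (psi := idfun)) => [c|i] /=.
  by rewrite split_varC join_varC insert_varC.
by rewrite split_varX; case: unliftP => [i'|] -> /=;
  rewrite ?join_varX ?join_varC ?insert_varX.
Qed.

Lemma split_insert u : split_var (insert_var u) = u%:P.
Proof.
apply: (mpoly_rmorphism_ext
  (phi := split_var \o insert_var) (psi := polyC)) => [c|i] /=.
  by rewrite insert_varC split_varC.
by rewrite insert_varX split_varX liftK.
Qed.

Lemma join_varK : cancel join_var split_var.
Proof.
elim/poly_ind => [|h c IHh]; first by rewrite !rmorph0.
rewrite !rmorphD !rmorphM /= IHh join_varX join_varC split_insert.
by rewrite split_varX unlift_none.
Qed.

Lemma poly_inE u : poly_in j u = map_poly insert_var (split_var u).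
Proof.
apply: (mpoly_rmorphism_ext
  (phi := mmap (polyC \o @mpolyC k.+1 K)
            (fun i => if i == j then 'X else ('X_i)%:P))
  (psi := map_poly insert_var \o split_var)) => [c|i] /=.
  by rewrite mmapC split_varC map_polyC /= insert_varC.
rewrite mmapX mmap1U split_varX.
case: unliftP => [i'|] -> /=; last by rewrite eqxx map_polyX.
by rewrite eq_sym (negPf (neq_lift _ _)) map_polyC /= insert_varX.
Qed.

Lemma degX_split_var u : degX j u = (size (split_var u)).-1.
Proof.
by rewrite /degX poly_inE (size_map_inj_poly insert_var_inj) // rmorph0.
Qed.

(** Inverting the nonzero polynomials free of X_j makes the multivariate
    ring a principal ideal domain, while keeping the degree in X_j. *)
Definition localize : {mpoly K[k.+1]} -> {poly {fraction {mpoly K[k]}}} :=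
  map_poly (@tofrac {mpoly K[k]}) \o split_var.

HB.instance Definition _ := GRing.RMorphism.on localize.

End SplitVariable.

Lemma localize_inj (K : fieldType) (k : nat) (j : 'I_k.+1) :
  injective (@localize K k j).
Proof.
apply: inj_comp; last exact: can_inj (@split_varK K k j).
apply: map_inj_poly; last exact: rmorph0.
exact: tofrac_inj.
Qed.

Lemma pdeg_localize (K : fieldType) (k : nat) (j : 'I_k.+1)
    (u : {mpoly K[k.+1]}) :
  pdeg (localize j u) = degX j u.
Proof.
rewrite degX_split_var /pdeg /localize /= size_map_inj_poly ?rmorph0 //.
exact: tofrac_inj.
Qed.

(** A factorization over the fraction field of K[other variables] becomes,
    after clearing denominators, a relation [c *: p = h1 * h2] in the
    polynomial ring; primality puts [p] inside one factor, so the other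
    one is constant. *)
Lemma prime_irreducible_localize (K : fieldType) (k : nat) (j : 'I_k.+1)
    (p : {mpoly K[k.+1]}) :
  prime_element p -> (0 < degX j p)%N -> irreducible_poly (localize j p).
Proof.
move=> [p_neq0 _ prime_p]; rewrite degX_split_var => p_gt0.
apply/irreducible_tofrac/irreducible_polyI.
  by move: p_gt0; case: (size _) => [|[]].
move=> c h1 h2 c_neq0 def_p.
have split_neq0 : split_var j p != 0.
  by rewrite -size_poly_gt0; case: (size _) p_gt0.
have : c *: split_var j p != 0 by rewrite scale_poly_eq0 negb_or c_neq0.
rewrite def_p mulf_eq0 negb_or => /andP[h1_neq0 h2_neq0].
have size_p : size (split_var j p) = (size h1 + size h2).-1.
  by rewrite -size_mul // -def_p size_scale.
have size_dvd h : h != 0 -> divides p (join_var j h) ->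
    (size (split_var j p) <= size h)%N.
  move=> h_neq0 [s def_h]; have := congr1 (split_var j) def_h.
  rewrite join_varK rmorphM /= => {}def_h.
  by apply: Pdiv.Idomain.dvdp_leq => //; rewrite def_h Pdiv.Idomain.dvdp_mulr.
have pred_le l1 l2 : (0 < l1 -> (l1 + l2).-1 <= l1 -> l2 <= 1)%N by clear; lia.
have := prime_p (join_var j h1) (join_var j h2).
case.
- exists (join_var j c%:P).
  by rewrite -rmorphM -def_p -mul_polyC rmorphM /= split_varK mulrC.
- move/(size_dvd _ h1_neq0); rewrite size_p => le1; apply/orP; right.
  by apply: pred_le le1; rewrite size_poly_gt0.
move/(size_dvd _ h2_neq0); rewrite size_p addnC => le2; apply/orP; left.
by apply: pred_le le2; rewrite size_poly_gt0.
Qed.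

(** * The criterion in several variables *)

(* K[X_1, ..., X_(r-1)] is {mpoly K[r.-1]}; a polynomial in X_1, ..., X_r is
   written as a polynomial in X_r over that ring, so that substituting g for
   X_r in f is f \Po g. *)
Theorem corollary6 (K : fieldType) (r m n : nat)
    (hr : (2 <= r)%N) (hm : (1 <= m)%N) (hn : (1 <= n)%N)
    (f g : {poly {mpoly K[r.-1]}})
    (hf : (size f <= m.+1)%N) (hg : (size g <= n.+1)%N)
    (hne : f`_0 * f`_m * g`_n != 0)
    (p q : {mpoly K[r.-1]}) (hpq : f`_m = p * q) (hp : prime_element p)
    (j : 'I_r.-1)
    (hdeg : (degX j p > maxn ((m - 1) * degX j q)
                             ((n - 1) * degX j q + m * n * degX j (g`_n)%R)
                        + Hdeg j f)%N) :
  irreducible_poly (map_poly (@tofrac {mpoly K[r.-1]}) (f \Po g)).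
Proof.
case: r hr f g hf hg hne p q hpq hp j hdeg => [|[|k]] //= _.
move=> f g hf hg hne p q hpq hp j hdeg.
move: hne; rewrite !mulf_eq0 !negb_or => /andP[/andP[f0_neq0 fm_neq0] gn_neq0].
have size_eq (h : {poly {mpoly K[k.+1]}}) d : (size h <= d.+1)%N -> h`_d != 0 ->
    size h = d.+1.
  move=> le_h; apply: contra_neq_eq => neq_h; apply: nth_default.
  by rewrite -ltnS ltn_neqAle neq_h.
have size_f := size_eq f m hf fm_neq0; have size_g := size_eq g n hg gn_neq0.
apply/irreducible_tofrac/(irreducible_of_injective (@localize_inj K k j)).
have size_localize (h : {poly {mpoly K[k.+1]}}) :
    size (map_poly (localize j) h) = size h.
  by apply: size_map_inj_poly; [apply: localize_inj | apply: rmorph0].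
have localize_neq0 (u : {mpoly K[k.+1]}) : u != 0 -> localize j u != 0.
  by apply: contra_neq => u0; apply: (@localize_inj K k j); rewrite u0 rmorph0.
rewrite map_comp_poly.
apply: (@irreducible_comp_big_prime _ _ _
  (localize j p) (localize j q) m n (Hdeg j f)) => //.
- by apply: prime_irreducible_localize hp _; apply: leq_ltn_trans hdeg.
- by rewrite size_localize.
- by rewrite size_localize.
- by rewrite coef_map localize_neq0.
- by rewrite lead_coefE size_localize size_f coef_map -rmorphM -hpq.
- move=> i lt_i; rewrite coef_map pdeg_localize.
  have [->|fi_neq0] := eqVneq f`_i 0.
    by rewrite -pdeg_localize rmorph0 /pdeg size_poly0.
  have lt_i' : (i < (size f).-1)%N by rewrite size_f.
  exact: (leq_bigmax_cond (Ordinal lt_i') fi_neq0).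
have bound P Q G : P = degX j p -> Q = degX j q -> G = degX j g`_n ->
    (maxn ((m - 1) * Q) ((n - 1) * Q + m * n * G) + Hdeg j f < P)%N.
  by move=> -> -> ->.
apply: bound; [exact: pdeg_localize | exact: pdeg_localize |].
rewrite -pdeg_localize; congr pdeg.
by rewrite lead_coefE size_localize size_g coef_map.
Qed.
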